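(* (1) Let $(A,\mu,\alpha)$ be a finite-dimensional semi-simple Hom-alternative algebra. Then $(A,\mu,\alpha)$ is of alternative type and its induced alternative algebra $(A,\mu')$ is also semi-simple. (2) Let $(A,\mu')$ be a semi-simple alternative algebra such that $A$ has a decomposition $A=\bigoplus_{i=1}^s A_i$ where the $A_i$ ($1\leq i\leq s$) are simple two-sided ideals of $(A,\mu')$. Moreover let $\alpha\in\mathrm{Aut}(A,\mu')$ satisfy $\alpha(A_i)=A_i$ for $1\leq i\leq s$. Then $(A,\mu=\alpha\circ\mu',\alpha)$ is a semi-simple Hom-alternative algebra and has the unique decomposition (as a direct sum of simple two-sided Hom-ideals).
   Context: All vector spaces are over a fixed field $\mathbb{K}$ of characteristic $0$. A Hom-algebra is a triple $(A,\mu,\alpha)$ with $A$ a vector space, $\mu:A\otimes A\to A$ linear and $\alpha:A\to A$ linear; it is multiplicative if $\alpha\circ\mu=\mu\circ(\alpha\otimes\alpha)$. Its Hom-associator is $as_A(x,y,z)=\mu(\mu(x,y),\alpha(z))-\mu(\alpha(x),\mu(y,z))$. A Hom-alternative algebra is a multiplicative Hom-algebra with $as_A(x,x,y)=0$ and $as_A(x,y,y)=0$ for all $x,y\in A$. A two-sided Hom-ideal is a linear subspace $H\subseteq A$ such that $\alpha(H)\subseteq H$ and $\mu(a,b),\mu(b,a)\in H$ for all $a\in A$, $b\in H$. A Hom-alternative algebra $(A,\mu,\alpha)$ with $\alpha\neq 0$ is simple if $\mu(A,A)\neq\{0\}$ and it has no proper two-sided Hom-ideal (i.e. none other than $\{0\}$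 and $A$). A Hom-alternative algebra $(A,\mu,\alpha)$ with $\alpha\ne0$ is semi-simple if $A=A_1\oplus A_2\oplus\cdots\oplus A_p$ where the $A_i$ are simple two-sided Hom-ideals of $(A,\mu,\alpha)$, i.e. two-sided Hom-ideals that are simple Hom-alternative algebras with the restricted operations. $(A,\mu,\alpha)$ is of alternative type if there is an alternative algebra $(A,\mu')$ with $\mu=\alpha\circ\mu'$; $(A,\mu')$ is then called the induced (compatible) alternative algebra; when $\alpha$ is invertible, $\mu'=\alpha^{-1}\circ\mu$. An alternative algebra is simple if its product is nonzero and it has no two-sided ideal other than $\{0\}$ and itself; it is semi-simple if it is a direct sum of finitely many simple two-sided ideals. *)

(* Defs.v *)
From HB Require Import structures.
From mathcomp Require Import all_boot all_order all_algebra.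
From mathcomp Require Import boolp classical_sets.

Set Implicit Arguments.
Unset Strict Implicit.
Unset Printing Implicit Defensive.

Import GRing.Theory.

Local Open Scope classical_set_scope.
Local Open Scope ring_scope.

(* Subspaces are sets of vectors rather than {vspace A}, because A may be
   infinite-dimensional. Every algebra notion takes a carrier C : set A, so that
   a subspace with the restricted operations is an algebra without a new type;
   an algebra on the whole of A is the case C = setT. *)

Section Subspaces.
Variables (K : fieldType) (A : lmodType K).
Implicit Types C I : set A.

Definition linear_subspace C : Prop :=
  C 0 /\ forall (c : K) x y, C x -> C y -> C (c *: x + y).

(* Bijectivity of the sum map from the product of the B i to A; {ffun _} makes
   [exists!] mean uniqueness of the values. *)
Definition direct_sum (p : nat) (B : 'I_p -> set A) : Prop :=
  (forall i, linear_subspace (B i)) /\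
  forall x : A, exists! u : {ffun 'I_p -> A},
    (forall i, B i (u i)) /\ x = \sum_i u i.

End Subspaces.

Section AlternativeAlgebras.
Variables (K : fieldType) (A : lmodType K) (mu : {bilinear A -> A -> A}).
Implicit Types C I : set A.

Definition associator (x y z : A) : A := mu (mu x y) z - mu x (mu y z).

Definition alternative_on C : Prop :=
  [/\ linear_subspace C,
      forall x y, C x -> C y -> C (mu x y) &
      forall x y, C x -> C y -> associator x x y = 0 /\ associator x y y = 0].

Definition two_sided_ideal C I : Prop :=
  [/\ linear_subspace I, I `<=` C &
      forall a b, C a -> I b -> I (mu a b) /\ I (mu b a)].

Definition alternative_simple C : Prop :=
  [/\ alternative_on C,
      exists a b, [/\ C a, C b & mu a b <> 0] &
      forall I, two_sided_ideal C I -> I = [set 0] \/ I = C].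

Definition alternative_decomposition (p : nat) (B : 'I_p -> set A) : Prop :=
  direct_sum B /\
  forall i, two_sided_ideal setT (B i) /\ alternative_simple (B i).

Definition alternative_semisimple : Prop :=
  alternative_on setT /\
  exists (p : nat) (B : 'I_p -> set A), alternative_decomposition B.

Definition algebra_automorphism (alpha : {linear A -> A}) : Prop :=
  bijective alpha /\ forall x y, alpha (mu x y) = mu (alpha x) (alpha y).

End AlternativeAlgebras.

Section HomAlgebras.
Variables (K : fieldType) (A : lmodType K).
Variables (mu : {bilinear A -> A -> A}) (alpha : {linear A -> A}).
Implicit Types C I : set A.

Definition hom_associator (x y z : A) : A :=
  mu (mu x y) (alpha z) - mu (alpha x) (mu y z).

Definition hom_alternative_on C : Prop :=
  [/\ linear_subspace C,
      forall x, C x -> C (alpha x),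
      forall x y, C x -> C y -> C (mu x y),
      forall x y, C x -> C y -> alpha (mu x y) = mu (alpha x) (alpha y) &
      forall x y, C x -> C y ->
        hom_associator x x y = 0 /\ hom_associator x y y = 0].

Definition hom_ideal C I : Prop :=
  [/\ linear_subspace I, I `<=` C, forall x, I x -> I (alpha x) &
      forall a b, C a -> I b -> I (mu a b) /\ I (mu b a)].

Definition hom_simple C : Prop :=
  [/\ hom_alternative_on C,
      exists x, C x /\ alpha x <> 0,
      exists a b, [/\ C a, C b & mu a b <> 0] &
      forall I, hom_ideal C I -> I = [set 0] \/ I = C].

Definition hom_decomposition (p : nat) (B : 'I_p -> set A) : Prop :=
  direct_sum B /\ forall i, hom_ideal setT (B i) /\ hom_simple (B i).

Definition hom_semisimple : Prop :=
  [/\ hom_alternative_on setT,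
      exists x, alpha x <> 0 &
      exists (p : nat) (B : 'I_p -> set A), hom_decomposition B].

Definition induced_alternative (mu' : {bilinear A -> A -> A}) : Prop :=
  alternative_on mu' setT /\ forall x y, mu x y = alpha (mu' x y).

Definition alternative_type : Prop :=
  exists mu' : {bilinear A -> A -> A}, induced_alternative mu'.

End HomAlgebras.

Section Twist.
Variables (K : fieldType) (A : lmodType K).
Variables (alpha : {linear A -> A}) (mu' : {bilinear A -> A -> A}).

Definition twist (x y : A) : A := alpha (mu' x y).

Lemma twist_is_bilinear :
  bilinear_for (GRing.Scale.Law.clone _ _ *:%R _)
               (GRing.Scale.Law.clone _ _ *:%R _) twist.
Proof.
by split=> u c x y; rewrite /twist ?linearPl ?linearPr linearP.
Qed.

HB.instance Definition _ :=
  bilinear_isBilinear.Build K A A A _ _ twist twist_is_bilinear.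

End Twist.

(* Main.v *)
Require Import Defs.
From mathcomp Require Import all_boot all_order all_algebra.
From mathcomp Require Import boolp classical_sets.

(** Untwisting.  On a simple Hom-ideal the kernel of alpha is a Hom-ideal, so
    alpha is injective there, hence on the whole direct sum.  When it is
    bijective, mu = alpha o mu' defines mu', of which alpha is then an
    automorphism, and the Hom-associator of mu is alpha^2 applied to the
    associator of mu'.  The problem in both directions is therefore to
    compare the ideals of mu' with the alpha-stable ones.

    Finite-dimensional case.  The annihilator of mu' is zero, because its part
    in each simple summand is a Hom-ideal of the summand.  The socle, the sum of
    all minimal ideals of mu', is alpha-stable since an automorphism permutes
    the minimal ideals; it meets every simple Hom-summand in a nonzero Hom-ideal,
    so it is everything.  An algebra with zero annihilator that is the sum of its
    minimal ideals is the direct sum of some of them, and these are simple: an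
    ideal of a direct summand is an ideal of the algebra
    ([semisimple_full_socle]).

    Twisting a simple algebra.  A Hom-ideal I of the twist of a simple
    alternative algebra C is only forward stable under alpha, and C may be
    infinite-dimensional.  The subspaces T_m = alpha^-m (I) satisfy
    C T_m + T_m C <= T_(m+1), so their increasing union is an ideal; if I is
    nonzero this union is C, and one has to show that C is some T_m already,
    which gives I = alpha^m (C) = C.  In an alternative algebra, a multiplication
    by a moves past a multiplication by c at the cost of one multiplication by
    a c or c a:
      a (c y) = (a c + c a) y - c (a y),
      (c y) a = c (y a) + c (a y) - (c a) y,
    and symmetrically ([exchange_products]).  Let core_k be the set of elements
    of T_(m+2) that remain in T_(m+2) under any k multiplications.  Elements of
    T_(m+1) map core_k into itself, and elements of T_m gain one degree: they
    map core_k into core_(k+1).  Now fix x <> 0.  By simplicity x is obtained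
    from x by a sum of nonempty words of multiplications; the finitely many
    letters lie in some T_m, as does x.  Hence x in core_k implies x in
    core_(k+1), so x lies in every core_k; the intersection of the core_k is a
    nonzero ideal, and C <= T_(m+2) ([simple_filtration_stationary]).

    Uniqueness.  A simple summand C_j of one Hom-decomposition meets some
    summand B_i of another nontrivially, since otherwise it would annihilate
    the whole algebra; the intersection is a Hom-ideal of both, so C_j = B_i. *)

Set Implicit Arguments.
Unset Strict Implicit.
Unset Printing Implicit Defensive.

Import GRing.Theory.

Local Open Scope classical_set_scope.
Local Open Scope ring_scope.

(** * Linear subspaces *)

Section Subspaces.
Variables (K : fieldType) (A : lmodType K).
Implicit Types (C D : set A) (x y : A).

Lemma subspace0 C : linear_subspace C -> C 0.
Proof. by case. Qed.

Lemma subspaceD C x y : linear_subspace C -> C x -> C y -> C (x + y).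
Proof. by move=> [_ CL] Cx Cy; rewrite -[x]scale1r; apply: CL. Qed.

Lemma subspaceN C x : linear_subspace C -> C x -> C (- x).
Proof.
by move=> [C0 CL] Cx; rewrite -scaleN1r -[_ *: x]addr0; apply: CL.
Qed.

Lemma subspaceB C x y : linear_subspace C -> C x -> C y -> C (x - y).
Proof. by move=> sC Cx Cy; apply: subspaceD => //; apply: subspaceN. Qed.

Lemma subspaceI C D :
  linear_subspace C -> linear_subspace D -> linear_subspace (C `&` D).
Proof.
move=> [C0 CL] [D0 DL]; split; first by split.
by move=> c x y [Cx Dx] [Cy Dy]; split; [apply: CL | apply: DL].
Qed.

End Subspaces.

(** * Direct sums of ideals *)

Section DirectSums.
Variables (K : fieldType) (A : lmodType K) (p : nat) (B : 'I_p -> set A).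
Hypothesis dB : direct_sum B.

Lemma direct_sum_exists x :
  exists u : 'I_p -> A, (forall i, B i (u i)) /\ x = \sum_i u i.
Proof. by case: dB => _ /(_ x) [u [? _]]; exists u. Qed.

(** A common element of two summands has two decompositions, concentrated in
    either summand, which must agree. *)
Lemma direct_sum_disjoint i j x : i != j -> B i x -> B j x -> x = 0.
Proof.
move=> ij Bi Bj; have [sB /(_ x) [u [_ uni]]] := dB.
pose single k := [ffun l => if l == k then x else 0] : {ffun 'I_p -> A}.
have single_ok k : B k x ->
    (forall l, B l (single k l)) /\ x = \sum_l single k l.
  move=> Bk; split=> [l|].
    by rewrite ffunE; case: eqP => [->|_] //; apply: subspace0.
  rewrite (bigD1 k) //= ffunE eqxx big1 ?addr0 // => l /negPf lk.
  by rewrite ffunE lk.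
have eq_ij : single i = single j.
  by rewrite -(uni _ (single_ok i Bi)) -(uni _ (single_ok j Bj)).
by have /ffunP/(_ i) := eq_ij; rewrite !ffunE eqxx (negPf ij).
Qed.

Lemma direct_sum_component0 (u : 'I_p -> A) :
  (forall i, B i (u i)) -> \sum_i u i = 0 -> forall i, u i = 0.
Proof.
move=> Bu u0 i; have [sB /(_ 0) [v [_ uni]]] := dB.
have vu : v = [ffun j => u j].
  by apply: uni; split=> [j|]; rewrite ?ffunE // (eq_bigr u) // => j _; rewrite ffunE.
have v0 : v = [ffun j => 0].
  apply: uni; split=> [j|]; first by rewrite ffunE; apply: subspace0.
  by rewrite big1 // => j _; rewrite ffunE.
by have /ffunP/(_ i) := vu; rewrite v0 !ffunE.
Qed.

Variable mu : {bilinear A -> A -> A}.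
Hypothesis idB : forall i a b, B i b -> B i (mu a b) /\ B i (mu b a).

(** The product lies in both summands. *)
Lemma mul_distinct_summands i j x y :
  i != j -> B i x -> B j y -> mu x y = 0.
Proof.
move=> ij Bx By; apply: (@direct_sum_disjoint i j) => //.
  by have [] := idB y Bx.
by have [] := idB x By.
Qed.

Lemma mul_summand_component i (u : 'I_p -> A) x :
  (forall j, B j (u j)) -> B i x ->
  mu x (\sum_j u j) = mu x (u i) /\ mu (\sum_j u j) x = mu (u i) x.
Proof.
move=> Bu Bx; rewrite linear_sumr linear_sumlz.
split; rewrite (bigD1 i) //= big1 ?addr0 // => j ji.
  by apply: (@mul_distinct_summands i j); rewrite // eq_sym.
by apply: (mul_distinct_summands ji).
Qed.

(** The other summands annihilate [B i], so multiplying an element of [I] by any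
    [a] amounts to multiplying it by the component of [a] in [B i]. *)
Lemma summand_ideal i (I : set A) :
  two_sided_ideal mu (B i) I -> two_sided_ideal mu setT I.
Proof.
move=> [sI IB idI]; split=> // a b _ Ib.
have [u [Bu ->]] := direct_sum_exists a.
have [-> ->] := mul_summand_component Bu (IB _ Ib).
exact: idI.
Qed.

Lemma annihilator_direct_sum x :
  (forall i y, B i y ->
     (forall a, B i a -> mu y a = 0 /\ mu a y = 0) -> y = 0) ->
  (forall a, mu x a = 0 /\ mu a x = 0) -> x = 0.
Proof.
have [u [Bu ->]] := direct_sum_exists x => annB annx.
apply: big1 => i _; apply: (annB i) => // a Ba.
by have [<- <-] := mul_summand_component Bu Ba; have [] := annx a.
Qed.

End DirectSums.

(** * Exchanging multiplications in an alternative algebra *)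

Section AlternativeIdentities.
Variables (K : fieldType) (A : lmodType K) (mu : {bilinear A -> A -> A}).
Variable C : set A.
Hypothesis altC : alternative_on mu C.
Implicit Types x y z a c : A.

Local Notation "x ** y" := (mu x y) (at level 40, left associativity).

Lemma associatorDl x x' y z :
  associator mu (x + x') y z = associator mu x y z + associator mu x' y z.
Proof. by rewrite /associator !linearDl opprD addrACA. Qed.

Lemma associatorDm x y y' z :
  associator mu x (y + y') z = associator mu x y z + associator mu x y' z.
Proof. by rewrite /associator !(linearDl, linearDr) opprD addrACA. Qed.

Lemma associatorDr x y z z' :
  associator mu x y (z + z') = associator mu x y z + associator mu x y z'.
Proof. by rewrite /associator !linearDr opprD addrACA. Qed.

Lemma associator_swap12 x y z : C x -> C y -> C z ->
  associator mu x y z = - associator mu y x z.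
Proof.
move=> Cx Cy Cz; have [sC _ alt] := altC; apply/eqP; rewrite -addr_eq0.
have [] := alt _ z (subspaceD sC Cx Cy) Cz.
rewrite associatorDl !associatorDm.
by have [-> _] := alt x z Cx Cz; have [-> _] := alt y z Cy Cz;
  rewrite add0r addr0 => ->.
Qed.

Lemma associator_swap23 x y z : C x -> C y -> C z ->
  associator mu x y z = - associator mu x z y.
Proof.
move=> Cx Cy Cz; have [sC _ alt] := altC; apply/eqP; rewrite -addr_eq0.
have [] := alt x (y + z) Cx (subspaceD sC Cy Cz).
rewrite associatorDm !associatorDr.
by have [_ ->] := alt x y Cx Cy; have [_ ->] := alt x z Cx Cz;
  rewrite add0r addr0 => _ ->.
Qed.

Lemma associator_def x y z : x ** y ** z = associator mu x y z + x ** (y ** z).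
Proof. by rewrite /associator subrK. Qed.

Lemma associator_def' x y z : x ** (y ** z) = x ** y ** z - associator mu x y z.
Proof. by rewrite /associator subKr. Qed.

(** By skew symmetry of the associator, a multiplication by [c] followed by one
    by [a] can be replaced by words in which [c] acts last or is absorbed into
    [a c] or [c a]: both associators that occur are, up to sign, [(c, a, y)] or
    [(y, a, c)], and these are differences of elements assumed to lie in [P]. *)
Lemma exchange_products (P : set A) a c y :
  linear_subspace P -> C a -> C c -> C y ->
  P (c ** (a ** y)) -> P (c ** (y ** a)) ->
  P (a ** y ** c) -> P (y ** a ** c) ->
  P (a ** c ** y) -> P (c ** a ** y) -> P (y ** (a ** c)) -> P (y ** (c ** a)) ->
  [/\ P (a ** (c ** y)), P (c ** y ** a), P (a ** (y ** c)) & P (y ** c ** a)].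
Proof.
move=> sP Ca Cc Cy P1 P2 P3 P4 P5 P6 P7 P8.
have Pcay : P (associator mu c a y) by apply: subspaceB.
have Pyac : P (associator mu y a c) by apply: subspaceB.
split.
- rewrite associator_def' associator_swap12 // opprK; exact: subspaceD.
- rewrite associator_def associator_swap23 // addrC; exact: subspaceB.
- rewrite associator_def' associator_swap12 // opprK; exact: subspaceD.
- rewrite associator_def associator_swap23 // addrC; exact: subspaceB.
Qed.

End AlternativeIdentities.

(** * Filtrations of a simple alternative algebra *)

Section Core.
Variables (K : fieldType) (A : lmodType K) (mu : {bilinear A -> A -> A}).
Variable C : set A.
Hypothesis altC : alternative_on mu C.
Implicit Types (T : set A).

Local Notation "x ** y" := (mu x y) (at level 40, left associativity).

(** The elements that stay in [T] under at most [k] successive multiplications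
    by elements of [C]; their intersection over [k] is the largest ideal of [C]
    contained in [T]. *)
Fixpoint core T k : set A :=
  if k is k'.+1 then
    [set x | T x /\ forall a, C a -> core T k' (a ** x) /\ core T k' (x ** a)]
  else T.

Let sC : linear_subspace C. Proof. by case: altC. Qed.
Let CM x y : C x -> C y -> C (x ** y).
Proof. by case: altC => _ + _; apply. Qed.

Lemma core_sub T k : core T k `<=` T.
Proof. by case: k => [|k] x // []. Qed.

Lemma coreS T k : core T k.+1 `<=` core T k.
Proof.
elim: k => [|k IH] x; first by case.
by case=> Tx cx; split=> // a Ca; have [? ?] := cx a Ca; split; apply: IH.
Qed.

Lemma core_subspace T k : linear_subspace T -> linear_subspace (core T k).
Proof.
move=> sT; elim: k => [|k IH] //; split=> [|c x y [Tx cx] [Ty cy]].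
  split=> [|a _]; first exact: subspace0.
  by rewrite linear0r linear0l; split; apply: subspace0.
split=> [|a Ca]; first by case: sT => _; apply.
have [cx1 cx2] := cx a Ca; have [cy1 cy2] := cy a Ca.
by rewrite linearPr linearPl; case: IH => _ coreL; split; apply: coreL.
Qed.

(** [B], [D] and [T] model three consecutive terms of a filtration that
    grows by one step under each multiplication. *)
Section Absorption.
Variables B D T : set A.
Hypotheses (sT : linear_subspace T) (TC : T `<=` C).
Hypotheses (DC : D `<=` C) (BC : B `<=` C).
Hypothesis DT : forall a d, C a -> D d -> T (a ** d) /\ T (d ** a).
Hypothesis BD : forall a b, C a -> B b -> D (a ** b) /\ D (b ** a).
Hypothesis BT : forall a b, C a -> B b -> T (a ** b) /\ T (b ** a).

(** Once [d] has been moved to the outermost place, the product is in [T] because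
    of [d] alone; where [d] is absorbed, what remains is a single multiplication
    of [y], whose effect on the core is controlled since [y] is deep enough. *)
Lemma mul_core d y k : D d -> core T k y ->
  core T k (d ** y) /\ core T k (y ** d).
Proof.
move=> Dd; elim: k y => [|k IH] y coy.
  by have [] := DT (TC coy) Dd.
have Ty := core_sub coy; have Cy := TC Ty; have Cd := DC Dd.
have [Tyd Tdy] := DT Cy Dd.
have exch a : C a -> [/\ core T k (a ** (d ** y)), core T k (d ** y ** a),
    core T k (a ** (y ** d)) & core T k (y ** d ** a)].
  move=> Ca; have cy b : C b -> core T k (b ** y) /\ core T k (y ** b).
    exact: (proj2 coy).
  have [cay cya] := cy a Ca.
  have [??] := IH _ cay; have [??] := IH _ cya.
  have [??] := cy _ (CM Ca Cd); have [??] := cy _ (CM Cd Ca).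
  by apply: (exchange_products altC) => //; apply: core_subspace.
by split; split=> // a /exch [].
Qed.

(** The gain of one degree comes from absorption: moving a new factor [a] past
    [b] produces [a b] and [b a], which lie in [D] and so preserve the core. *)
Lemma mul_coreS b y k : B b -> core T k y ->
  core T k.+1 (b ** y) /\ core T k.+1 (y ** b).
Proof.
move=> Bb; have Cb := BC Bb; elim: k y => [|k IH] y coy.
  have Cy := TC coy; have [Tyb Tby] := BT Cy Bb.
  have exch a : C a -> [/\ T (a ** (b ** y)), T (b ** y ** a),
      T (a ** (y ** b)) & T (y ** b ** a)].
    move=> Ca; have [Dab Dba] := BD Ca Bb.
    have [??] := BT (CM Ca Cy) Bb; have [??] := BT (CM Cy Ca) Bb.
    have [??] := DT Cy Dab; have [??] := DT Cy Dba.
    exact: (exchange_products altC).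
  by split; split=> // a /exch [].
have Cy := TC (core_sub coy); have [Tyb Tby] := BT Cy Bb.
have exch a : C a -> [/\ core T k.+1 (a ** (b ** y)), core T k.+1 (b ** y ** a),
    core T k.+1 (a ** (y ** b)) & core T k.+1 (y ** b ** a)].
  move=> Ca; have [cay cya] := proj2 coy a Ca.
  have [Dab Dba] := BD Ca Bb.
  have [??] := IH _ cay; have [??] := IH _ cya.
  have [??] := mul_core Dab coy; have [??] := mul_core Dba coy.
  by apply: (exchange_products altC) => //; apply: core_subspace.
by split; split=> // a /exch [].
Qed.

End Absorption.

(** The annihilator of a simple algebra is an ideal, and it is proper because
    the product is not zero. *)
Lemma simple_annihilator x : alternative_simple mu C -> C x ->
  (forall a, C a -> x ** a = 0 /\ a ** x = 0) -> x = 0.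
Proof.
move=> [_ [a [b [Ca Cb ab0]]] simC] Cx annx.
pose I := [set y | C y /\ forall a, C a -> y ** a = 0 /\ a ** y = 0].
have [|I0|IC] := simC I.
- split=> [||c y Cc [Cy anny]]; last first.
  + have [yc0 cy0] := anny c Cc; rewrite yc0 cy0.
    have I0 : I 0 by split; [apply: subspace0 | move=> d; rewrite linear0r linear0l].
    by [].
  + by move=> y [].
  + split; first by split; [apply: subspace0 | move=> d; rewrite linear0r linear0l].
    move=> c y z [Cy yP] [Cz zP]; split; first by case: sC => _; apply.
    move=> d Cd; have [y1 y2] := yP d Cd; have [z1 z2] := zP d Cd.
    by rewrite linearPl linearPr y1 y2 z1 z2 scaler0 addr0.
- by have : I x by []; rewrite I0.
have [_ /(_ b Cb) [] //] : I a by rewrite IC.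
Qed.

Section Filtration.
Hypothesis simC : alternative_simple mu C.
Variable T : nat -> set A.
Hypotheses (sT : forall m, linear_subspace (T m)) (TC : forall m, T m `<=` C).
Hypothesis Tmono : forall m, T m `<=` T m.+1.
Hypothesis Tcover : forall x, C x -> exists m, T m x.
Hypothesis TM : forall m a x, C a -> T m x ->
  T m.+1 (a ** x) /\ T m.+1 (x ** a).

Lemma filtration_le m n : (m <= n)%N -> T m `<=` T n.
Proof.
by move/subnK <-; elim: (n - m)%N => // k IH x /IH; apply: Tmono.
Qed.

Lemma filtration_mul m b y k : T m b -> core (T m.+2) k y ->
  core (T m.+2) k.+1 (b ** y) /\ core (T m.+2) k.+1 (y ** b).
Proof.
apply: (@mul_coreS (T m) (T m.+1)) => //; try exact: TC.
- by move=> a d; apply: TM.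
- by move=> a d; apply: TM.
- by move=> a d Ca /(TM Ca) [??]; split; apply: Tmono.
Qed.

(** A simple alternative algebra is not the union of a strictly growing
    filtration of this kind: some element, hence the ideal that it generates,
    already stays in a fixed term under arbitrarily many multiplications. *)
Lemma simple_filtration_stationary : exists m, C `<=` T m.
Proof.
have [_ [a0 [b0 [Ca0 Cb0 ab0]]] simI] := simC.
have [x [Cx x0]] : exists x, C x /\ x <> 0.
  by exists a0; split=> // a00; apply: ab0; rewrite a00 linear0l.
(* [D] stands for the elements obtained from [x] by nonempty words of
   multiplications: they gain one degree over [x] in the core of every late
   enough term. *)
pose D := [set z | C z /\ exists m, forall n k, (m <= n)%N ->
  core (T n.+2) k x -> core (T n.+2) k.+1 z].
have xD b : C b -> D (b ** x) /\ D (x ** b).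
  move=> Cb; have [m Tb] := Tcover Cb.
  by split; split; [exact: CM | | exact: CM | ]; exists m => n k mn cox;
    have [] := filtration_mul (filtration_le mn Tb) cox.
have idD : two_sided_ideal mu C D.
  split=> [||b z Cb [Cz [m Dz]]]; first split.
  - split; first exact: subspace0.
    by exists 0%N => n k _ _; apply: subspace0 (core_subspace k.+1 (sT n.+2)).
  - move=> c y z [Cy [m1 Dy]] [Cz [m2 Dz]]; split; first by case: sC => _; apply.
    exists (maxn m1 m2) => n k; rewrite geq_max => /andP [n1 n2] cox.
    have [_ coreL] := @core_subspace (T n.+2) k.+1 (sT _).
    by apply: coreL; [apply: Dy | apply: Dz].
  - by move=> z [].
  have [m' Tb] := Tcover Cb.
  by split; split; [exact: CM | | exact: CM | ]; exists (maxn m m') => n k;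
    rewrite geq_max => /andP [n1 n2] cox;
    have [] := filtration_mul (filtration_le n2 Tb) (coreS (Dz n k n1 cox)).
have Dx : D x.
  have [D0|DC] := simI D idD; last by rewrite DC.
  case: x0; apply: simple_annihilator => // a Ca.
  by have := xD a Ca; rewrite D0 => - [-> ->].
have [_ [m Dm]] := Dx; have [m' Tx] := Tcover Cx.
pose n := maxn m m'.
(* [x] itself belongs to [D], so it climbs through all degrees of the core *)
have cox k : core (T n.+2) k x.
  elim: k => [|k IH]; last by apply: Dm => //; apply: leq_maxl.
  by do 2!apply: Tmono; apply: filtration_le Tx; apply: leq_maxr.
exists n.+2; pose J := [set z | forall k, core (T n.+2) k z].
have JC : two_sided_ideal mu C J.
  split=> [||b z Cb Jz]; first split.
  - by move=> k; apply: subspace0 (core_subspace k (sT n.+2)).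
  - move=> c y z Jy Jz k; have [_ coreL] := @core_subspace (T n.+2) k (sT _).
    exact: coreL.
  - by move=> z /(_ 0%N); apply: TC.
  by split=> k; have [_ /(_ b Cb) []] := Jz k.+1.
have [J0|<-] := simI J JC; last by move=> z /(_ 0%N).
by case: x0; have : J x by []; rewrite J0.
Qed.

End Filtration.
End Core.

(** * Twisting by an automorphism *)

Section Twisting.
Variables (K : fieldType) (A : lmodType K).
Variables (mu : {bilinear A -> A -> A}) (alpha : {linear A -> A}).
Hypothesis autA : algebra_automorphism mu alpha.
Variable C : set A.
Hypothesis alphaC : alpha @` C = C.

Let alphaM x y : alpha (mu x y) = mu (alpha x) (alpha y).
Proof. by case: autA. Qed.
Let alpha_inj : injective alpha.
Proof. by apply: bij_inj; case: autA. Qed.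
Let alpha_stable x : C x -> C (alpha x).
Proof. by move=> Cx; rewrite -alphaC; exists x. Qed.

Lemma hom_associator_twist x y z :
  hom_associator (twist alpha mu) alpha x y z =
  alpha (alpha (associator mu x y z)).
Proof. by rewrite /hom_associator /= /twist /associator !linearB /= !alphaM. Qed.

Lemma twist_hom_alternative :
  alternative_on mu C -> hom_alternative_on (twist alpha mu) alpha C.
Proof.
move=> [sC CM alt]; split=> //= [x y Cx Cy|x y Cx Cy|x y Cx Cy].
- by apply: alpha_stable; apply: CM.
- by rewrite /twist alphaM.
- by rewrite !hom_associator_twist; have [-> ->] := alt x y Cx Cy;
    rewrite !linear0.
Qed.

Lemma twist_hom_ideal D : alpha @` D `<=` D -> two_sided_ideal mu C D ->
  hom_ideal (twist alpha mu) alpha C D.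
Proof.
move=> alphaD [sD DC DM]; split=> // [x Dx|a b Ca Db].
  by apply: alphaD; exists x.
by have [??] := DM a b Ca Db; split; apply: alphaD; [exists (mu a b) | exists (mu b a)].
Qed.

(** The iterated preimages of a nonzero Hom-ideal filter [C] and exhaust it;
    stationarity of the filtration forces the Hom-ideal to be [C]. *)
Lemma twist_hom_simple :
  alternative_simple mu C -> hom_simple (twist alpha mu) alpha C.
Proof.
move=> simC; have [altC [a [b [Ca Cb ab0]]] simI] := simC.
have [sC CM _] := altC.
have alpha0 x : x <> 0 -> alpha x <> 0.
  by move=> x0 ax0; apply: x0; apply: alpha_inj; rewrite linear0.
split; first exact: twist_hom_alternative.
- by exists a; split=> //; apply: alpha0 => a0; apply: ab0; rewrite a0 linear0l.
- by exists a, b; split=> //; apply: alpha0.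
move=> I [sI IC alphaI IM].
have iterM m x y : iter m alpha (mu x y) = mu (iter m alpha x) (iter m alpha y).
  by elim: m => //= m ->; rewrite alphaM.
have iterL m c x y : iter m alpha (c *: x + y) = c *: iter m alpha x + iter m alpha y.
  by elim: m => //= m ->; rewrite linearP.
have iter0 m : iter m alpha 0 = 0 by elim: m => //= m ->; rewrite linear0.
have iterC m x : C x -> C (iter m alpha x).
  by move=> Cx; elim: m => //= m; apply: alpha_stable.
have iterC_surj m y : C y -> exists2 x, C x & iter m alpha x = y.
  elim: m y => [|m IH] y Cy; first by exists y.
  rewrite -alphaC in Cy; have [z /IH [x Cx <-] <-] := Cy.
  by exists x.
(* one more iterate turns a product for [mu] into a product for the twist, which
   [I] absorbs; this is the shift from [T m] to [T m.+1] *)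
pose T m := [set x | C x /\ I (iter m alpha x)].
have sT m : linear_subspace (T m).
  split=> [|c x y [Cx Ix] [Cy Iy]]; first by split; rewrite ?iter0; apply: subspace0.
  split; first by case: sC => _; apply.
  by rewrite iterL; case: sI => _; apply.
have TC m : T m `<=` C by move=> x [].
have Tmono m : T m `<=` T m.+1 by move=> x [Cx Ix]; split=> //; apply: alphaI.
have TM m c x : C c -> T m x -> T m.+1 (mu c x) /\ T m.+1 (mu x c).
  move=> Cc [Cx Ix]; have [??] := IM _ _ (iterC m c Cc) Ix.
  by split; (split; first exact: CM); rewrite /= iterM.
pose U := [set x | exists m, T m x].
have idU : two_sided_ideal mu C U.
  split=> [||c x Cc [m Tx]].
  - split=> [|c x y [m Tx] [n Ty]]; first by exists 0%N; apply: subspace0.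
    exists (maxn m n); have [_ TL] := sT (maxn m n).
    by apply: TL; [apply: filtration_le Tx | apply: filtration_le Ty];
      rewrite // ?leq_maxl ?leq_maxr.
  - by move=> x [m /TC].
  by have [??] := TM m c x Cc Tx; split; exists m.+1.
have [U0|UC] := simI U idU; [left|right]; apply/seteqP; split=> // x.
- by move=> Ix; rewrite -U0; exists 0%N; split=> //; apply: IC.
- by move=> ->; apply: subspace0.
have Tcover y : C y -> exists m, T m y by rewrite -{1}UC.
have [m CT] := simple_filtration_stationary altC simC sT TC Tmono Tcover TM.
by move=> /(iterC_surj m) [y /CT [_ Iy] <-].
Qed.

End Twisting.

(** * Decompositions into simple Hom-ideals *)

Section HomDecompositions.
Variables (K : fieldType) (A : lmodType K).
Variables (mu : {bilinear A -> A -> A}) (alpha : {linear A -> A}).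

Lemma hom_ideal_closed p (B : 'I_p -> set A) :
  (forall i, hom_ideal mu alpha setT (B i)) ->
  forall i a b, B i b -> B i (mu a b) /\ B i (mu b a).
Proof. by move=> idB i a b Bb; have [_ _ _] := idB i; apply. Qed.

Lemma hom_simple_cap C D :
  hom_simple mu alpha C -> hom_ideal mu alpha setT C ->
  hom_ideal mu alpha setT D -> C `&` D = [set 0] \/ C `&` D = C.
Proof.
move=> [_ _ _ simC] [sC _ alphaC CM] [sD _ alphaD DM]; apply: simC; split.
- exact: subspaceI.
- by move=> x [].
- by move=> x [Cx Dx]; split; [apply: alphaC | apply: alphaD].
move=> a b Ca [Cb Db]; have [??] := CM a b I Cb; have [??] := DM a b I Db.
by [].
Qed.

(** If [C j] met every [B i] trivially, all products of [C j] with the [B i], and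
    so the product of [C j] with the whole algebra, would vanish. *)
Lemma hom_decomposition_sub p (B : 'I_p -> set A) q (C : 'I_q -> set A) :
  hom_decomposition mu alpha B -> hom_decomposition mu alpha C ->
  forall j, exists i, C j = B i.
Proof.
move=> [dB BP] [dC CP] j; apply: contrapT => noB.
have [idC simC] := CP j.
have cap0 i : C j `&` B i = [set 0].
  have [idB simB] := BP i.
  have [//|CB] := hom_simple_cap simC idC idB.
  have [//|BC] := hom_simple_cap simB idB idC; first by rewrite setIC.
  by case: noB; exists i; rewrite -CB -[RHS]BC setIC.
have [_ _ [a [b [Ca Cb ab0]]] _] := simC.
apply: ab0; have [u [Bu ->]] := direct_sum_exists dB b.
rewrite linear_sumr; apply: big1 => i _.
have [_ _ _ CM] := idC; have [[_ _ _ BM] _] := BP i.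
have : (C j `&` B i) (mu a (u i)).
  by split; [have [] := CM (u i) a I Ca | have [] := BM a (u i) I (Bu i)].
by rewrite cap0.
Qed.

Lemma hom_decomposition_inj p (B : 'I_p -> set A) :
  hom_decomposition mu alpha B -> injective B.
Proof.
move=> [dB BP] i j Bij; apply: contrapT => /eqP ij.
have [_ [_ [x [Bx ax0]] _ _]] := BP i; apply: ax0.
by rewrite (direct_sum_disjoint dB ij Bx) ?linear0 // -Bij.
Qed.

Lemma hom_decomposition_unique p (B : 'I_p -> set A) q (C : 'I_q -> set A) :
  hom_decomposition mu alpha B -> hom_decomposition mu alpha C ->
  exists sigma : 'I_q -> 'I_p, bijective sigma /\ forall j, C j = B (sigma j).
Proof.
move=> decB decC.
have [sigma CB] := choice (hom_decomposition_sub decB decC).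
have [tau BC] := choice (hom_decomposition_sub decC decB).
exists sigma; split=> //; exists tau => [j|i].
  by apply: (hom_decomposition_inj decC); rewrite -BC CB.
by apply: (hom_decomposition_inj decB); rewrite -CB BC.
Qed.

(** The kernel of [alpha] is a Hom-ideal by multiplicativity, and it is proper
    because [alpha] does not vanish on [C]. *)
Lemma hom_simple_ker C x :
  hom_simple mu alpha C -> C x -> alpha x = 0 -> x = 0.
Proof.
move=> [[sC alphaC CM multC _] [y [Cy ay0]] _ simC] Cx ax0.
pose I := [set z | C z /\ alpha z = 0].
have [|I0|IC] := simC I; last 2 first.
- by have : I x by []; rewrite I0.
- by have [] : I y by rewrite IC.
split=> [||z [Cz ->]|a b Ca [Cb b0]].
- split=> [|c z t [Cz z0] [Ct t0]]; first by split; rewrite ?linear0 //; apply: subspace0.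
  by split; [case: sC => _; apply | rewrite linearP z0 t0 scaler0 addr0].
- by move=> z [].
- by split; rewrite ?linear0 //; apply: subspace0.
by do 2!split; do ?exact: CM; rewrite multC // b0 ?linear0r ?linear0l.
Qed.

Lemma hom_decomposition_alpha_inj p (B : 'I_p -> set A) :
  hom_decomposition mu alpha B -> injective alpha.
Proof.
move=> [dB BP]; apply: raddf_inj => x ax0.
have [u [Bu xE]] := direct_sum_exists dB x.
suff u0 i : u i = 0 by rewrite xE big1.
have [idB simB] := BP i; apply: (hom_simple_ker simB) => //.
apply: (@direct_sum_component0 _ _ _ _ dB (fun j => alpha (u j))) => [j|].
  by have [[_ _ + _] _] := BP j; apply.
by rewrite -linear_sum -xE.
Qed.

End HomDecompositions.

(** * Subspaces of a finite-dimensional space *)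

Section FiniteDimension.
Variables (K : fieldType) (A : vectType K).
Implicit Types (U V : {vspace A}).

Lemma max_dim_vspace (P : {vspace A} -> Prop) U0 : P U0 ->
  exists U, P U /\ forall V, P V -> (\dim V <= \dim U)%N.
Proof.
move=> PU0.
pose Q n := `[< exists U, P U /\ \dim U = n >].
have exQ : exists n, Q n by exists (\dim U0); apply/asboolP; exists U0.
have bQ n : Q n -> (n <= \dim {:A})%N.
  by move/asboolP=> [U [_ <-]]; apply/dimvS/subvf.
case: (ex_maxnP exQ bQ) => n /asboolP [U [PU <-]] maxU.
by exists U; split=> // V PV; apply: maxU; apply/asboolP; exists V.
Qed.

Lemma min_dim_vspace (P : {vspace A} -> Prop) U0 : P U0 ->
  exists U, P U /\ forall V, P V -> (\dim U <= \dim V)%N.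
Proof.
move=> PU0.
pose Q n := `[< exists U, P U /\ \dim U = n >].
have exQ : exists n, Q n by exists (\dim U0); apply/asboolP; exists U0.
case: (ex_minnP exQ) => n /asboolP [U [PU <-]] minU.
by exists U; split=> // V PV; apply: minU; apply/asboolP; exists V.
Qed.

Lemma subspace_vspace (C : set A) :
  linear_subspace C -> exists U, forall x, x \in U <-> C x.
Proof.
move=> sC; have CL : forall c x y, C x -> C y -> C (c *: x + y) by case: sC.
have [|U [UC maxU]] :=
    @max_dim_vspace (fun U => forall x, x \in U -> C x) 0%VS.
  by move=> x; rewrite memv0 => /eqP ->; apply: subspace0.
exists U => x; split=> [|Cx]; first exact: UC.
have UxC y : y \in (U + <[x]>)%VS -> C y.
  move=> /memv_addP [u /UC Cu [_ /vlineP [c ->] ->]].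
  by rewrite addrC; apply: CL.
have := maxU _ UxC => dimUx.
have /eqP -> : U == (U + <[x]>)%VS by rewrite eqEdim addvSl.
by apply: subvP (addvSr U <[x]>) _ _; apply: memv_line.
Qed.

Lemma vspace_subspace U : linear_subspace [set x | x \in U].
Proof.
split=> [|c x y /= Ux Uy]; first exact: mem0v.
by apply: memvD => //; apply: memvZ.
Qed.

Variable alpha : {linear A -> A}.
Hypothesis alpha_inj : injective alpha.

Lemma ker_linfun : lker (linfun alpha) == 0%VS.
Proof. by apply/lker0P => x y; rewrite !lfunE; apply: alpha_inj. Qed.

Definition inverse_map : {linear A -> A} := ((linfun alpha)^-1)%VF.

Lemma inverse_mapK : cancel alpha inverse_map.
Proof. by move=> x; rewrite -[alpha x]lfunE; apply: lker0_lfunK ker_linfun _. Qed.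

Lemma inverse_mapVK : cancel inverse_map alpha.
Proof. by move=> x; rewrite -[LHS]lfunE; apply: lker0_lfunVK ker_linfun _. Qed.

Lemma stable_subspace_inverse (C : set A) x : linear_subspace C ->
  (forall y, C y -> C (alpha y)) -> C (alpha x) -> C x.
Proof.
move=> sC alphaC; have [U UP] := subspace_vspace sC.
have fU : (linfun alpha @: U)%VS = U.
  apply/eqP; rewrite eqEdim limg_dim_eq ?leqnn ?andbT.
    by apply/subvP => _ /memv_imgP [u /UP/alphaC Cu ->]; rewrite lfunE; apply/UP.
  by rewrite (eqP ker_linfun) capv0.
move=> /UP; rewrite -{1}fU => /memv_imgP [u Uu].
by rewrite lfunE => /alpha_inj ->; apply/UP.
Qed.

End FiniteDimension.

(** * The socle of a finite-dimensional algebra *)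

Section Socle.
Variables (K : fieldType) (A : vectType K) (mu : {bilinear A -> A -> A}).
Implicit Types (U V M : {vspace A}).

Definition ideal_vspace U := two_sided_ideal mu setT [set x | x \in U].

Definition minimal_ideal M :=
  [/\ ideal_vspace M, M != 0%VS &
      forall V, ideal_vspace V -> (V <= M)%VS -> V != 0%VS -> V = M].

Lemma ideal_vspaceP U :
  ideal_vspace U <-> forall a b, b \in U -> mu a b \in U /\ mu b a \in U.
Proof.
split=> [[_ _ UM] a b Ub|UM]; first exact: UM.
by split=> // [|a b _]; [apply: vspace_subspace | apply: UM].
Qed.

Lemma ideal_vspace_cap U V :
  ideal_vspace U -> ideal_vspace V -> ideal_vspace (U :&: V).
Proof.
move=> /ideal_vspaceP UM /ideal_vspaceP VM; apply/ideal_vspaceP => a b.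
rewrite !memv_cap => /andP [/(UM a) [-> ->] /(VM a) [-> ->]] //.
Qed.

Lemma ideal_vspace_sum (s : seq {vspace A}) :
  (forall M, M \in s -> ideal_vspace M) -> ideal_vspace (\sum_(M <- s) M).
Proof.
move=> ids; rewrite big_tnth; apply/ideal_vspaceP => a _ /memv_sumP [u su ->].
rewrite linear_sumr linear_sumlz.
split; apply: memv_sumr => i _;
  by have /ids/ideal_vspaceP/(_ a _ (su i isT)) [] := mem_tnth i (in_tuple s).
Qed.

Lemma minimal_ideal_exists U : ideal_vspace U -> U != 0%VS ->
  exists2 M, minimal_ideal M & (M <= U)%VS.
Proof.
move=> idU U0; pose P V := [/\ ideal_vspace V, (V <= U)%VS & V != 0%VS].
have [|M [[idM MU M0] minM]] := @min_dim_vspace _ _ P U; first by [].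
exists M => //; split=> // V idV VM V0; apply/eqP; rewrite eqEdim VM.
by apply: minM; split=> //; apply: subv_trans MU.
Qed.

(** Among the sums of independent families of minimal ideals, one of maximal
    dimension contains every minimal ideal [M]: otherwise [M] meets it in zero
    and can be added to the family.  So the socle comes at once as a direct sum. *)
Lemma socle_exists : exists s : seq {vspace A},
  [/\ forall M, M \in s -> minimal_ideal M,
      \dim (\sum_(M <- s) M) = (\sum_(M <- s) \dim M)%N &
      forall M, minimal_ideal M -> (M <= \sum_(N <- s) N)%VS].
Proof.
pose P U := exists s : seq {vspace A},
  [/\ forall M, M \in s -> minimal_ideal M,
      \dim (\sum_(M <- s) M) = (\sum_(M <- s) \dim M)%N & U = (\sum_(M <- s) M)%VS].
have [|_ [[s [mins dims ->]] maxs]] := @max_dim_vspace _ _ P 0%VS.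
  by exists [::]; rewrite !big_nil dimv0.
exists s; split=> // M minM; have [idM M0 minM'] := minM.
set S := (\sum_(N <- s) N)%VS in maxs *.
have idS : ideal_vspace S by apply: ideal_vspace_sum => N /mins [].
have [MS0|MS0] := eqVneq (M :&: S)%VS 0%VS; last first.
  by rewrite -(minM' _ (ideal_vspace_cap idM idS) (capvSl M S) MS0) capvSr.
have dimMS : \dim (M + S)%VS = (\dim M + \dim S)%N by apply: dimv_disjoint_sum.
have /maxs : P (M + S)%VS.
  exists (M :: s); split; rewrite ?big_cons ?dimMS ?dims //.
  by move=> N; rewrite inE => /orP [/eqP -> | /mins].
by rewrite dimMS -[leqRHS]add0n leq_add2r leqn0 dimv_eq0 (negPf M0).
Qed.

End Socle.

Section SocleDecomposition.
Variables (K : fieldType) (A : vectType K) (mu : {bilinear A -> A -> A}).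
Implicit Types (U V M : {vspace A}).

Lemma vspace_direct_sum n (M : 'I_n -> {vspace A}) :
  \dim (\sum_i M i) = (\sum_i \dim (M i))%N -> (\sum_i M i)%VS = fullv ->
  direct_sum (fun i => [set x | x \in M i]).
Proof.
move=> dimM fullM; split=> [i|x]; first exact: vspace_subspace.
have dM : directv (\sum_i M i) by apply/directvP.
have /memv_sumP [u Mu xE] : x \in (\sum_i M i)%VS by rewrite fullM memvf.
exists [ffun i => u i]; split=> [|v [Mv xv]].
  split=> [i|]; first by rewrite ffunE; apply: Mu.
  by rewrite xE; apply: eq_bigr => i _; rewrite ffunE.
have := directv_sum_unique dM u v Mu (fun i _ => Mv i).
rewrite -xE -xv eqxx => /esym/forallP uv.
by apply/ffunP => i; rewrite ffunE; apply/eqP/uv.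
Qed.

(** A minimal ideal with zero product would annihilate the algebra, as the other
    summands annihilate it anyway. *)
Lemma semisimple_full_socle (s : seq {vspace A}) :
  alternative_on mu setT ->
  (forall x, (forall a, mu x a = 0 /\ mu a x = 0) -> x = 0) ->
  (forall M, M \in s -> minimal_ideal mu M) ->
  \dim (\sum_(M <- s) M) = (\sum_(M <- s) \dim M)%N ->
  (\sum_(M <- s) M)%VS = fullv ->
  alternative_semisimple mu.
Proof.
move=> altA ann0 mins dims fulls; split=> //.
pose M i := tnth (in_tuple s) i.
have minM i : minimal_ideal mu (M i) by apply: mins; apply: mem_tnth.
exists (size s), (fun i => [set x | x \in M i]).
rewrite big_tnth in fulls; rewrite (big_tnth 0%VS) (big_tnth 0%N) in dims.
have fM : (\sum_i M i)%VS = fullv := fulls.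
have dM : direct_sum (fun i => [set x | x \in M i]) := vspace_direct_sum dims fM.
split=> // i; have [idM M0 minMi] := minM i; split=> //.
have MM j a b : b \in M j -> mu a b \in M j /\ mu b a \in M j.
  by have [/ideal_vspaceP idMj _ _] := minM j; apply: idMj.
have [_ _ alt] := altA; split.
- split; first exact: vspace_subspace.
    by move=> x y _ /= My; have [] := MM i x y My.
  by move=> x y _ _; apply: alt.
- apply: contrapT => mu0; case/negP: M0; rewrite -subv0.
  apply/subvP => x Mx; rewrite memv0; apply/eqP/ann0 => a.
  have [u [Mu ->]] := direct_sum_exists dM a.
  have [-> ->] := mul_summand_component dM MM Mu Mx.
  by split; apply: contrapT => mun0; apply: mu0;
    [exists x, (u i) | exists (u i), x]; split=> //; apply: Mu.
move=> I idI; have [sI IM _] := idI.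
have [U UI] := subspace_vspace sI.
have IE : I = [set x | x \in U] by apply/seteqP; split=> x /UI.
have idU : ideal_vspace mu U.
  by rewrite /ideal_vspace -IE; exact: (@summand_ideal _ _ _ _ dM _ MM i).
have UM : (U <= M i)%VS by apply/subvP => x /UI/IM.
rewrite IE; have [->|U0] := eqVneq U 0%VS; [left|right].
  by apply/seteqP; split=> x /=; rewrite memv0 => /eqP.
by rewrite (minMi U).
Qed.

Lemma minimal_ideal_image (alpha : {linear A -> A}) M :
  algebra_automorphism mu alpha -> minimal_ideal mu M ->
  minimal_ideal mu (linfun alpha @: M).
Proof.
move=> [[beta alphaK betaK] alphaM] [/ideal_vspaceP idM M0 minM].
have alpha_inj : injective alpha := can_inj alphaK.
have ker0 := ker_linfun alpha_inj.
have idM' : ideal_vspace mu (linfun alpha @: M).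
  apply/ideal_vspaceP => a _ /memv_imgP [x Mx ->].
  have [Mbx Mxb] := idM (beta a) x Mx.
  rewrite lfunE -(betaK a) -!alphaM.
  by split; apply/memv_imgP; [exists (mu (beta a) x) | exists (mu x (beta a))];
    rewrite ?lfunE.
split=> // [|V /ideal_vspaceP idV VM V0].
  by rewrite -dimv_eq0 limg_dim_eq ?(eqP ker0) ?capv0 // dimv_eq0.
pose W := (linfun alpha @^-1: V)%VS.
have fW : (linfun alpha @: W)%VS = V.
  by apply: lpreimK; apply: subv_trans VM _; apply: limgS; apply: subvf.
have idW : ideal_vspace mu W.
  apply/ideal_vspaceP => a x; rewrite -!memv_preim !lfunE /= => Vx.
  by rewrite !alphaM; apply: idV.
rewrite -fW (minM W) //; first by rewrite -(limg_ker0 _ _ ker0) fW.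
by apply: contraNneq V0 => W0; rewrite -fW W0 limg0.
Qed.

End SocleDecomposition.

(** * The induced alternative algebra *)

Section InducedAlgebra.
Variables (K : fieldType) (A : vectType K).
Variables (mu : {bilinear A -> A -> A}) (alpha : {linear A -> A}).
Variables (p : nat) (B : 'I_p -> set A).
Hypothesis homA : hom_alternative_on mu alpha setT.
Hypothesis decB : hom_decomposition mu alpha B.

Let alpha_inj : injective alpha := hom_decomposition_alpha_inj decB.
Let alphaM x y : alpha (mu x y) = mu (alpha x) (alpha y).
Proof. by case: homA => _ _ _ + _; apply. Qed.

(** The Hom-associator of [mu] is the image under [alpha] applied twice of the
    associator of the untwisted product. *)
Lemma hom_semisimple_alternative_type : alternative_type mu alpha.
Proof.
pose beta := inverse_map alpha.
have betaK x : alpha (beta x) = x := inverse_mapVK alpha_inj x.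
exists (twist beta mu); split=> [|x y]; last by rewrite /= /twist betaK.
have as0 x y z : alpha (alpha (associator (twist beta mu) x y z)) =
    hom_associator mu alpha x y z.
  by rewrite /associator /= /twist !linearB /= !(betaK, alphaM).
have [_ _ _ _ homalt] := homA; split=> // x y _ _.
have [h1 h2] := homalt x y I I.
by split; apply: alpha_inj; apply: alpha_inj; rewrite as0 !linear0.
Qed.

Variable mu' : {bilinear A -> A -> A}.
Hypothesis indA : induced_alternative mu alpha mu'.

Let muE x y : mu x y = alpha (mu' x y).
Proof. by case: indA. Qed.

Lemma induced_automorphism : algebra_automorphism mu' alpha.
Proof.
split; last by move=> x y; apply: alpha_inj; rewrite -!muE alphaM.
by exists (inverse_map alpha); [apply: inverse_mapK | apply: inverse_mapVK].
Qed.

Lemma induced_annihilator x :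
  (forall a, mu' x a = 0 /\ mu' a x = 0) -> x = 0.
Proof.
move=> annx; have [dB BP] := decB.
have idB := hom_ideal_closed (fun i => proj1 (BP i)).
apply: (annihilator_direct_sum dB idB) => [i y By anny|a]; last first.
  by have [xa0 ax0] := annx a; rewrite !muE xa0 ax0 linear0.
have [[sB _ alphaB _] [_ _ [c [d [Bc Bd cd0]]] simB]] := BP i.
pose Z := [set z | B i z /\ forall a, mu z a = 0 /\ mu a z = 0].
have Zy : Z y.
  split=> // a; have [u [Bu ->]] := direct_sum_exists dB a.
  by have [-> ->] := mul_summand_component dB idB Bu By; apply: anny.
have [|Z0|ZB] := simB Z; last 2 first.
- by rewrite Z0 in Zy.
- by have [_ /(_ d) [] //] : Z c by rewrite ZB.
split=> [||z [Bz zP]|a b _ [Bb bP]].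
- split=> [|k z t [Bz zP] [Bt tP]].
    by split=> [|a]; [apply: subspace0 | rewrite linear0l linear0r].
  split=> [|a]; first by case: sB => _; apply.
  have [z1 z2] := zP a; have [t1 t2] := tP a.
  by rewrite linearPl linearPr z1 z2 t1 t2 scaler0 addr0.
- by move=> z [].
- split=> [|a]; first exact: alphaB.
  rewrite -[a](inverse_mapVK alpha_inj) -!alphaM.
  by have [-> ->] := zP (inverse_map alpha a); rewrite linear0.
have [-> ->] := bP a.
have Z00 : Z 0 by split=> [|c']; [apply: subspace0 | rewrite linear0l linear0r].
by [].
Qed.

(** It suffices to see that the socle contains each simple Hom-ideal [B i].  It
    meets [B i] in a Hom-ideal, which is nonzero since [B i], being stable under
    the inverse of [alpha] by a dimension count, is an ideal of [mu'] and so
    contains a minimal one. *)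
Lemma induced_semisimple : alternative_semisimple mu'.
Proof.
have [s [mins dims maxs]] := socle_exists mu'.
have [altA _] := indA; have [dB BP] := decB.
apply: (semisimple_full_socle altA induced_annihilator mins dims).
set S := (\sum_(M <- s) M)%VS in maxs *.
have idS : forall a b, b \in S -> mu' a b \in S /\ mu' b a \in S.
  by apply/ideal_vspaceP; apply: ideal_vspace_sum => M /mins [].
have alphaS x : x \in S -> alpha x \in S.
  move=> Sx; have : (linfun alpha @: S <= S)%VS.
    rewrite limg_sum big_tnth; apply/subv_sumP => i _; apply: maxs.
    apply: (minimal_ideal_image induced_automorphism); apply: mins.
    exact: mem_tnth.
  by move/subvP; apply; apply/memv_imgP; exists x; rewrite ?lfunE.
have BS i x : B i x -> x \in S.
  move=> Bx; have [[sB _ alphaB BM] [_ _ [c [d [Bc Bd cd0]]] simB]] := BP i.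
  have [|BS0|BSB] := simB (B i `&` [set x | x \in S]); last first.
  - by have [] : (B i `&` [set x | x \in S]) x by rewrite BSB.
  - have [U UB] := subspace_vspace sB.
    have idU : ideal_vspace mu' U.
      apply/ideal_vspaceP => a b /UB Bb; have [Bab Bba] := BM a b I Bb.
      rewrite !muE in Bab Bba.
      by split; apply/UB; apply: (stable_subspace_inverse alpha_inj sB).
    have U0 : U != 0%VS.
      apply/eqP => U0; apply: cd0; have /UB := Bc.
      by rewrite U0 memv0 => /eqP ->; rewrite linear0l.
    have [M minM MU] := minimal_ideal_exists idU U0.
    have [_ /negP[]] := minM; rewrite -subv0; apply/subvP => y My.
    have : (B i `&` [set x | x \in S]) y.
      by split; [apply/UB; apply: subvP My | apply: subvP (maxs _ minM) _ My].
    by rewrite BS0 /= => ->; apply: mem0v.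
  split=> [||y [By Sy]|a b Ba [Bb Sb]].
  - exact: subspaceI (vspace_subspace S).
  - by move=> y [].
  - by split; [apply: alphaB | apply: alphaS].
  have [Bab Bba] := BM a b I Bb; have [Sab Sba] := idS a b Sb.
  by rewrite !muE in Bab Bba *; do 2!split=> //; apply: alphaS.
apply/eqP; rewrite eqEsubv subvf; apply/subvP => x _.
have [u [Bu ->]] := direct_sum_exists dB x.
by apply: rpred_sum => i _; apply: BS (Bu i).
Qed.

End InducedAlgebra.

(** * The theorem *)

Theorem theorem4p9 (K : fieldType) (charK0 : [pchar K] =i pred0) :
  (forall (A : vectType K)
          (mu : {bilinear A -> A -> A}) (alpha : {linear A -> A}),
     hom_semisimple mu alpha ->
     alternative_type mu alpha /\
     forall mu' : {bilinear A -> A -> A},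
       induced_alternative mu alpha mu' -> alternative_semisimple mu')
  /\
  (forall (A : lmodType K)
          (mu' : {bilinear A -> A -> A}) (alpha : {linear A -> A})
          (s : nat) (B : 'I_s -> set A),
     (0 < s)%N ->
     alternative_semisimple mu' ->
     alternative_decomposition mu' B ->
     algebra_automorphism mu' alpha ->
     (forall i, alpha @` B i = B i) ->
     [/\ hom_semisimple (twist alpha mu') alpha,
         hom_decomposition (twist alpha mu') alpha B &
         forall (p : nat) (C : 'I_p -> set A),
           hom_decomposition (twist alpha mu') alpha C ->
           exists sigma : 'I_p -> 'I_s,
             bijective sigma /\ forall j, C j = B (sigma j)]).
Proof.
split=> [A mu alpha [homA _ [p [B decB]]] |].
  split; first exact: hom_semisimple_alternative_type decB.
  by move=> mu'; apply: (induced_semisimple homA decB).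
move=> A mu' alpha s B s_gt0 [altA _] [dB BP] autA alphaB.
have decB : hom_decomposition (twist alpha mu') alpha B.
  split=> // i; have [idB simB] := BP i; split; last exact: twist_hom_simple.
  by apply: twist_hom_ideal => //; rewrite alphaB.
have alphaT : alpha @` setT = setT.
  case: autA => -[beta _ betaK] _; apply/seteqP; split=> // x _.
  by exists (beta x).
split=> // [|p C decC]; last exact: hom_decomposition_unique decB decC.
split; first exact: twist_hom_alternative.
- have [_ [_ [x [_ ax0]] _ _]] := proj2 decB (Ordinal s_gt0).
  by exists x.
- by exists s, B.
Qed.
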